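(* Consider the two-parameter mutual activation model $$\dot X_1=f(X_2)-cX_1,\qquad \dot X_2=X_1-dX_2,$$ where $f:\mathbb{R}\to\mathbb{R}$ is an unknown function and $c$ and $d$ are unknown real parameters. Then: (i) If only $X_1$ is observable then, provided $f$ is locally invertible and $c\neq 0$: if $f^{-1}$ is non-affine, then $f$, $c$ and $d$ are globally structurally identifiable; if $f^{-1}$ is affine, then $c$, $d$ and $f$ are each only locally identifiable (the slope of $f^{-1}$, however, is globally identifiable). (ii) If only $X_2$ is observable then $f$ is structurally non-identifiable and only the quantities $c+d$ and $f(X_2)-cdX_2$ are identifiable. Specifically, given any admissible triplet $(f_1,c_1,d_1)$, any alternative choice of the form $$c_2\in\mathbb{R},\qquad d_2=c_1+d_1-c_2,\qquad f_2(X_2)=f_1(X_2)+(c_2c_1+c_2d_1-c_2^2-c_1d_1)X_2,$$ yields dynamics identical to $(f_1,c_1,d_1)$ with respect to $X_2$.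
   Context: An ODE model has the form $\dot{\boldsymbol X}(t)=\boldsymbol F(\boldsymbol X;\boldsymbol f,\boldsymbol p)$, $\boldsymbol Y(t)=\boldsymbol H(\boldsymbol X(t))$, with state $\boldsymbol X\in\mathbb{R}^n$, observed output $\boldsymbol Y$ consisting of some or all of the state variables, known $\boldsymbol F,\boldsymbol H$, unknown scalar parameters $\boldsymbol p$, and unknown real-valued functions $\boldsymbol f$. Unknown functions are understood to be regular enough that solutions exist and the derivatives that occur make sense; a choice of unknowns is admissible if it is a possible choice of functions and parameters for the model. Two choices of the unknowns give the same observed outputs (yield identical dynamics with respect to the observed variable) if they produce the same output trajectory $\boldsymbol Y(t)$ for every initial condition consistent with prior knowledge of the initial conditions. Here the known initial conditions are $\boldsymbol Y(0)$; initial values of unobserved states are unknown and may differ between the two choices. Structural identifiability refers to the idealised case of arbitrary amounts of noiseless data, so that, in the differential equation involving only the observed variable, its derivatives and the unknowns (the input-output equation, obtained by eliminating the unobserved state), the observed variable and its lower-order derivatives are regarded as independently variable; two choices of unknowns are indistinguishable if they generate the same input-output equation. Fix a generic choice of the unknowns. An unknown function, parameter, or quantity formed from them is globally structurally identifiable (or simply identifiable) if every choice giving the same observed outputs as the fixed choice has the same value of it; locally structurally identifiable if there is $\varepsilon>0$ such that every choice giving the same observed outputs and for which it is within distance $<\varepsilon$ (sup norm over its domain for functions) has the same value of it (often, but not always, equivalent to only finitely many values giving the same observed dynamics); structurally non-identifiable otherwise. $f$ is locally invertible if it contains no flat regions ($f'=0$ only at isolated points); $f^{-1}$ then denotes its (local)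 inverse.
   Formalization: Non-identifiability of f in (ii) uses the sup norm over bounded sets (over R it fails: alternatives differ by kx); in (i), affine case, ''same'' means the unnormalized input-output equation; generic means d≠0 for f, c≠d, f(0)≠0 where needed; f is C^1. *)

(* Defs.v *)
From HB Require Import structures.
From mathcomp Require Import all_boot all_order all_algebra.
From mathcomp Require Import all_classical all_reals all_analysis.

Set Implicit Arguments.
Unset Strict Implicit.
Unset Printing Implicit Defensive.

Import Order.TTheory GRing.Theory Num.Theory.
Import numFieldNormedType.Exports.

Local Open Scope classical_set_scope.
Local Open Scope ring_scope.

(* The model is  X1' = f(X2) - c X1,  X2' = X1 - d X2. *)
Record unknowns (R : realType) := Unknowns {
  uf : R -> R;
  uc : R;
  ud : R
}.

Section Model.
Variable R : realType.
Implicit Types (th : unknowns R) (f g : R -> R).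

(* C^1 regularity of f: solutions exist and the second derivative of the
   observed variable makes sense. *)
Definition admissible th : Prop :=
  (forall x : R, derivable (uf th) x 1) /\ continuous (derive1 (uf th)).

(* The zeros of f' are isolated points. *)
Definition locally_invertible f : Prop :=
  forall x : R, derive1 f x = 0 -> \forall z \near x^', derive1 f z != 0.

(* g is a differentiable branch of f^-1 around w0.  Differentiability of g
   forces f' to be nonzero on the range of the branch, so the branches are the
   local inverses at the points where f' <> 0; f need not be monotone, and
   several branches may exist around the same w0. *)
Definition local_inverse f g (w0 : R) : Prop :=
  \forall w \near w0, derivable g w 1 /\ f (g w) = w.

(* f^-1 is w |-> a w + b. *)
Definition inverse_is_affine f (a b : R) : Prop :=
  forall (w0 : R) g, local_inverse f g w0 ->
    \forall w \near w0, g w = a * w + b.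

Definition has_affine_inverse f : Prop :=
  exists a b : R, inverse_is_affine f a b.

(* All the values taken by (f^-1)'; when f^-1 is affine, the singleton of its
   slope. *)
Definition inverse_slopes f : set R :=
  [set s | exists (w0 : R) g, local_inverse f g w0 /\ derive1 g w0 = s].

(** * Input-output equations *)

(* X1 observed.  The first equation gives X2 = f^-1(X1' + c X1); substituting
   in X2' = X1 - d X2 yields
     (f^-1)'(X1' + c X1) (X1'' + c X1') = X1 - d f^-1(X1' + c X1).
   [io_X1 g c d y v a] is left-hand side minus right-hand side for the branch g
   of f^-1, with y, v, a standing for X1, X1', X1''. *)
Definition io_X1 g (c d y v a : R) : R :=
  derive1 g (v + c * y) * (a + c * v) - (y - d * g (v + c * y)).

(* Around each (y, v), each input-output equation of th (one for each branch of
   f^-1) is matched, in the sense of rel, by one of th'. *)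
Definition io_X1_covered (rel : R -> R -> Prop) th th' : Prop :=
  forall (y v : R) g, local_inverse (uf th) g (v + uc th * y) ->
    exists2 g', local_inverse (uf th') g' (v + uc th' * y) &
      \forall y1 \near y & v1 \near v, forall a : R,
        rel (io_X1 g (uc th) (ud th) y1 v1 a)
            (io_X1 g' (uc th') (ud th') y1 v1 a).

(* The two choices generate the same input-output equation. *)
Definition same_io_X1 th th' : Prop :=
  let rel (e e' : R) := e = e' in
  io_X1_covered rel th th' /\ io_X1_covered rel th' th.

(* The two input-output equations have the same solutions (y, v, a), i.e. they
   determine the same X1''.  This is coarser than [same_io_X1], since the
   coefficient (f^-1)' of X1'' depends on the choice: for f^-1(w) = p w + q the
   equation [io_X1] = 0 has coefficients p, p (c + d), p c d - 1 and d q, of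
   which only the ratios are determined by its solutions. *)
Definition equiv_io_X1 th th' : Prop :=
  let rel (e e' : R) := e = 0 <-> e' = 0 in
  io_X1_covered rel th th' /\ io_X1_covered rel th' th.

(* X2 observed.  Substituting X1 = X2' + d X2 in the first equation yields
     X2'' + d X2' = f(X2) - c (X2' + d X2).  *)
Definition io_X2 th (y v a : R) : R :=
  (a + ud th * v) - (uf th y - uc th * (v + ud th * y)).

Definition same_io_X2 th th' : Prop :=
  forall y v a : R, io_X2 th y v a = io_X2 th' y v a.

(** * Output trajectories *)

(* A solution on [0, T[. *)
Definition solution th (T : R) (X1 X2 : R -> R) : Prop :=
  [/\ {within `[0, T[, continuous X1},
      {within `[0, T[, continuous X2} &
      forall t : R, t \in `]0, T[ ->
        is_derive t 1 X1 (uf th (X2 t) - uc th * X1 t) /\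
        is_derive t 1 X2 (X1 t - ud th * X2 t)].

(* Every X2-trajectory of th is one of th'; X2(0) is the same for both but the
   initial value of the unobserved X1 may differ. *)
Definition outputs_X2_included th th' : Prop :=
  forall (T : R) (X1 X2 : R -> R), 0 < T -> solution th T X1 X2 ->
    exists Z1 Z2 : R -> R,
      solution th' T Z1 Z2 /\ forall t : R, t \in `[0, T[ -> Z2 t = X2 t.

Definition same_outputs_X2 th th' : Prop :=
  outputs_X2_included th th' /\ outputs_X2_included th' th.

(** * Identifiability of a quantity q at the choice th, for a relation same of
    indistinguishability *)

Definition globally_identifiable (same : unknowns R -> unknowns R -> Prop)
    (V : Type) (q : unknowns R -> V) th : Prop :=
  forall th', admissible th' -> same th th' -> q th' = q th.

Definition locally_identifiable (same : unknowns R -> unknowns R -> Prop)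
    (V : Type) (dist : V -> V -> \bar R) (q : unknowns R -> V) th : Prop :=
  exists2 e : R, 0 < e &
    forall th', admissible th' -> same th th' ->
      (dist (q th') (q th) < e%:E)%E -> q th' = q th.

Definition nonidentifiable (same : unknowns R -> unknowns R -> Prop)
    (V : Type) (dist : V -> V -> \bar R) (q : unknowns R -> V) th : Prop :=
  ~ globally_identifiable same q th /\ ~ locally_identifiable same dist q th.

Definition only_locally_identifiable
    (same : unknowns R -> unknowns R -> Prop)
    (V : Type) (dist : V -> V -> \bar R) (q : unknowns R -> V) th : Prop :=
  locally_identifiable same dist q th /\ ~ globally_identifiable same q th.

Definition scalar_dist (x y : R) : \bar R := (`|x - y|)%:E.

(* Sup norm of f - g over D, the range of states on which values of the unknown
   function are compared.  D is a parameter because on the whole line two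
   functions that differ by a nonzero linear term, however small, are at
   infinite distance. *)
Definition sup_dist (D : set R) f g : \bar R :=
  ereal_sup [set (`|f x - g x|)%:E | x in D].

End Model.

(* Main.v *)
Require Import Defs.
From HB Require Import structures.
From mathcomp Require Import all_boot all_order all_algebra.
From mathcomp Require Import all_classical all_reals all_analysis.
From mathcomp Require Import ring lra.

Set Implicit Arguments.
Unset Strict Implicit.
Unset Printing Implicit Defensive.

Import Order.TTheory GRing.Theory Num.Theory.
Import numFieldNormedType.Exports.

Local Open Scope classical_set_scope.
Local Open Scope ring_scope.

(* (i) Where f' <> 0 there is a branch g of f^-1, and its input-output equation
   can be solved for X1'':
     - X1'' = c v + (d g(w) - y) / g'(w),   w = v + c y.
   Suppose (f2, c2, d2) gives the same X1''.  If c2 <> c, then v + c y and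
   v + c2 y are independent coordinates, and mixed second differences force
   1 / g' to be affine, say k w + l; moreover d g (k w + l) is then quadratic,
   and differentiating it shows that g itself is affine.  If all the branches
   are locally affine, then f' is locally constant off its isolated zeros, hence
   constant by continuity, so f^-1 is affine.  For f^-1 non-affine this gives
   c2 = c; comparing coefficients of y then gives equal g', and d2 = d; if d <> 0
   also the branches agree, and f2 = f since f' <> 0 on a dense set.
   For f^-1(w) = a w + b, equality of the equations means equality of a, c + d,
   c d and d b, so the only other solution exchanges c and d and replaces b by
   d b / c.
   (ii) The equation depends on th exactly through c + d and f(x) - c d x; a
   solution (X1, X2) becomes one for th' by adding (d' - d) X2 to X1. *)

(** * Neighbourhoods in one and two real variables *)

Lemma near_ballR (R : realType) (P : R -> Prop) (x : R) :
  (\forall y \near x, P y) ->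
  exists2 e : R, 0 < e & forall y, `|y - x| < e -> P y.
Proof.
move=> /nbhs_ballP[e e0 eP]; exists e => // y yx.
by apply: eP; rewrite /ball/= distrC.
Qed.

Lemma near_ballR2 (R : realType) (P : R -> R -> Prop) (x y : R) :
  (\forall z \near x & t \near y, P z t) ->
  exists2 e : R, 0 < e &
    forall z t, `|z - x| < e -> `|t - y| < e -> P z t.
Proof.
move=> [[A B]/= [/near_ballR[e e0 eA] /near_ballR[r r0 rB]] AB].
exists (Num.min e r); first by rewrite lt_min e0.
by move=> z t; rewrite !lt_min => /andP[ze _] /andP[_ tr];
  apply: (AB (z, t)); split; [exact: eA|exact: rB].
Qed.

Lemma ballR_near (R : realType) (P : R -> Prop) (x e : R) :
  0 < e -> (forall y, `|y - x| < e -> P y) -> \forall y \near x, P y.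
Proof.
move=> e0 eP; apply/nbhs_ballP; exists e => // y; rewrite /ball/= distrC.
exact: eP.
Qed.

(** Continuity of a linear map of the plane. It carries conditions near [(y, v)] over to coordinates
    in which the arguments of the branches are variables. *)
Lemma near_linear2 (R : realType) (P : R -> R -> Prop) (a b a' b' u v : R) :
  (\forall y \near (a * u + b * v) & z \near (a' * u + b' * v), P y z) ->
  \forall y \near u & z \near v, P (a * y + b * z) (a' * y + b' * z).
Proof.
move=> HP.
have lin (k l : R) : k * p.1 + l * p.2 @[p --> (u, v)] --> k * u + l * v.
  apply: cvgD; apply: cvgM; try exact: cvg_cst; [exact: cvg_fst|exact: cvg_snd].
exact: (cvg_pair (lin a b) (lin a' b')) HP.
Qed.

Lemma near_linear (R : realType) (P : R -> Prop) (a b u v : R) :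
  (\forall w \near (a * u + b * v), P w) ->
  \forall y \near u & z \near v, P (a * y + b * z).
Proof.
move=> HP; apply: (@near_linear2 _ (fun w _ => P w) a b a b).
by exists (P, setT) => [|p []]//; split=> //=; exact: filterT.
Qed.

(** * Functions with constant derivative near a point *)

Lemma derive0_itv_cst (R : realType) (f : R -> R) (a b : R) : a < b ->
  {within `[a, b], continuous f} ->
  (forall x, x \in `]a, b[ -> is_derive x 1 f 0) -> f b = f a.
Proof.
move=> ab fc fd.
have [c _ /eqP] := @MVT _ f (fun=> 0) a b ab fd fc.
by rewrite mul0r subr_eq0 => /eqP.
Qed.

Lemma near_derive0_cst (R : realType) (f : R -> R) (x0 : R) :
  (\forall x \near x0, is_derive x (1 : R) f 0) -> \forall x \near x0, f x = f x0.
Proof.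
move=> /near_ballR[e e0 eP]; apply: (ballR_near e0) => y yx.
have key a b : a < b -> (forall z, a <= z <= b -> `|z - x0| < e) -> f b = f a.
  move=> ab H; apply: derive0_itv_cst => //.
    apply: derivable_within_continuous => z; rewrite in_itv/= => /H zab.
    by case: (eP z zab).
  by move=> z; rewrite in_itv/= => /andP[az zb]; apply: eP; apply: H; rewrite !ltW.
move: yx; rewrite ltr_norml => /andP[? ?].
case: (ltgtP y x0) => [yx|xy|->//].
  by apply/esym/key => // z /andP[? ?]; rewrite ltr_norml; apply/andP; split; lra.
by apply: key => // z /andP[? ?]; rewrite ltr_norml; apply/andP; split; lra.
Qed.

Lemma is_derive1_derivable (R : realType) (f : R -> R) (x : R) :
  derivable f x 1 -> is_derive x 1 f (derive1 f x).
Proof. by move=> fx; rewrite derive1E; exact: derivableP. Qed.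

Lemma near_derive_cst_affine (R : realType) (f : R -> R) (x0 m : R) :
  (\forall x \near x0, is_derive x (1 : R) f m) ->
  \forall x \near x0, f x = m * x + (f x0 - m * x0).
Proof.
move=> fm.
have /near_derive0_cst : \forall x \near x0,
    is_derive x (1 : R) (fun x => f x - m * x) 0.
  near=> x.
  have fx : is_derive x 1 f m by near: x.
  by apply: is_derive_eq; rewrite /GRing.scale/=; ring.
by apply: filterS => x; move=> H; rewrite -H; ring.
Unshelve. all: by end_near. Qed.

Lemma is_derive1_affine (R : realType) (m q x : R) :
  is_derive x 1 (fun x => m * x + q) m.
Proof. by apply: is_derive_eq; rewrite /GRing.scale/=; ring. Qed.

Lemma near_affine_derive1 (R : realType) (g : R -> R) (m q w0 : R) :
  (\forall w \near w0, g w = m * w + q) ->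
  \forall w \near w0, derive1 g w = m.
Proof.
move=> /near_join; apply: filterS => w gw.
rewrite derive1E (near_eq_derive _ gw).
by case: (is_derive1_affine m q w).
Qed.

(** * Branches of the inverse function *)

Lemma local_inverse_at (R : realType) (f g : R -> R) (w0 : R) :
  local_inverse f g w0 -> f (g w0) = w0.
Proof. by move=> /nbhs_singleton[]. Qed.

Lemma near_local_inverse (R : realType) (f g : R -> R) (w0 : R) :
  local_inverse f g w0 -> \forall w \near w0, local_inverse f g w.
Proof. exact: near_join. Qed.

Lemma local_inverse_derive1 (R : realType) (f g : R -> R) (w0 : R) :
  (forall x, derivable f x 1) -> local_inverse f g w0 ->
  derive1 f (g w0) * derive1 g w0 = 1.
Proof.
move=> fd gf.
have [gd _] := nbhs_singleton gf.
have fg : \forall w \near w0, (f \o g) w = 1 * w + 0.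
  by apply: filterS gf => w [_ /=->]; rewrite mul1r addr0.
have <- : derive1 (f \o g) w0 = derive1 f (g w0) * derive1 g w0.
  exact: (derive1_comp gd (fd _)).
exact: (nbhs_singleton (near_affine_derive1 fg)).
Qed.

(** By continuity f' has no zero on a ball around [x0], so by the mean value theorem f is injective
    there; inverting f on this ball gives the branch. *)
Lemma local_inverse_exists (R : realType) (f : R -> R) (x0 : R) :
  (forall x, derivable f x 1) -> continuous (derive1 f) ->
  derive1 f x0 != 0 ->
  exists2 g, local_inverse f g (f x0) & g (f x0) = x0.
Proof.
move=> fd f'c f'0.
have fc : continuous f.
  by move=> x; apply/differentiable_continuous/derivable1_diffP.
have f'near : \forall x \near x0, derive1 f x != 0 by exact: cvgr_neq0 (f'c x0) _.
have [e e0 eP] := near_ballR f'near.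
pose J : set R := [set z | `|z - x0| < e].
have finj z t : J z -> J t -> f z = f t -> z = t.
  wlog zt : z t / z < t.
    by move=> W; case: (ltgtP z t) => // [/W|/W W' ? ? /esym /W' ->].
  move=> Jz Jt fzt.
  have f'z x : x \in `]z, t[ -> is_derive x 1 f (derive1 f x).
    by move=> _; exact: is_derive1_derivable.
  have [c] := @MVT _ f (derive1 f) z t zt f'z (continuous_subspaceT fc).
  rewrite in_itv/= fzt subrr => /andP[zc ct] /esym/eqP.
  rewrite mulf_eq0 => /orP[|]; last by rewrite subr_eq0 gt_eqF.
  move=> /eqP c0.
  have : J c.
    by move: Jz Jt; rewrite /J/= !ltr_norml => /andP[? ?] /andP[? ?];
      apply/andP; split; lra.
  by move=> /eP; rewrite c0 eqxx.
(* The default [x0], taken at values that f does not attain on the ball, is harmless: only values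
   near [f x0] matter. *)
pose g w := xget x0 [set z | J z /\ f z = w].
have fK z : J z -> g (f z) = z.
  by move=> Jz; rewrite /g; case: xgetP => [t _ [Jt ft]|/(_ z)[]//]; exact: finj.
have gK : \forall z \near x0, g (f z) = z.
  by apply: (ballR_near e0) => z; exact: fK.
have fcn : \forall z \near x0, {for z, continuous f} by near=> z; exact: fc.
have gfx0 : g (f x0) = x0 by exact: nbhs_singleton gK.
exists g => //.
have [gc fgK] := near_can_continuousAcan_sym gK fcn.
have gx0 : g w @[w --> f x0] --> x0.
  by rewrite -[X in _ --> X]gfx0; exact: (nbhs_singleton gc).
have gKg := gx0 _ (near_join gK); have f'g := gx0 _ f'near.
rewrite /local_inverse; near=> w.
have fgw : f (g w) = w by near: w; exact: fgK.
split=> //; rewrite -{1}fgw.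
suff [] : is_derive (f (g w)) 1 g (derive1 f (g w))^-1 by [].
apply: is_derive_inverse.
- by near: w; exact: gKg.
- by near=> z; exact: fc.
- exact: is_derive1_derivable.
- by near: w; exact: f'g.
Unshelve. all: by end_near. Qed.

(** Zeros of f' are isolated, so at such a zero [f] and [h] agree on a punctured neighbourhood and
    have the same limit there. *)
Lemma eq_of_dense_regular (R : realType) (f h : R -> R) :
  locally_invertible f -> continuous f -> continuous h ->
  (forall x, derive1 f x != 0 -> h x = f x) -> h = f.
Proof.
move=> fli fc hc fh; apply/funext => x.
have [f'x|/fh//] := eqVneq (derive1 f x) 0.
have hx : h z @[z --> x^'] --> h x by exact: cvg_trans (cvg_app _ (@nbhs_dnbhs _ x)) (hc x).
have fx : f z @[z --> x^'] --> f x by exact: cvg_trans (cvg_app _ (@nbhs_dnbhs _ x)) (fc x).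
suff hfx : h z @[z --> x^'] --> f x by exact: (cvg_unique _ hx hfx).
apply: cvg_trans fx; apply: near_eq_cvg.
by apply: filterS (fli x f'x) => z /fh.
Qed.

(** * Observed [X1]: comparing two input-output equations *)

Lemma near_io (R : realType) (P : R -> Prop) (c y v : R) :
  (\forall w \near (v + c * y), P w) ->
  \forall y1 \near y & v1 \near v, P (v1 + c * y1).
Proof.
move=> HP; have := @near_linear R P c 1 y v; rewrite mul1r addrC => /(_ HP).
by apply: filterS => -[y1 v1]/=; rewrite mul1r addrC.
Qed.

Lemma local_inverse_derive1_neq0 (R : realType) (f g : R -> R) (w0 : R) :
  (forall x, derivable f x 1) -> local_inverse f g w0 -> derive1 g w0 != 0.
Proof.
move=> fd gf; apply/eqP => g0.
by have /eqP := local_inverse_derive1 fd gf; rewrite g0 mulr0 eq_sym oner_eq0.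
Qed.

(* Mixed second differences of the hypothesis in [w] and [z] leave
   [(w - w') (psi z - psi z') + (z - z') (phi w - phi w') = 0]. *)
Lemma separated_affine (R : realType) (phi psi P Q : R -> R) (w0 z0 : R) :
  (\forall w \near w0 & z \near z0,
     (w - z) * (phi w - psi z) = P w - Q z) ->
  exists k l p q : R, \forall w \near w0,
    phi w = k * w + l /\ P w = k * w ^+ 2 + p * w + q.
Proof.
move=> /near_ballR2[e e0 eP].
pose s := z0 + e / 2.
have sz : s - z0 != 0 by rewrite /s addrAC subrr add0r; lra.
have z0e : `|z0 - z0| < e by rewrite subrr normr0.
have w0e : `|w0 - w0| < e by rewrite subrr normr0.
have se : `|s - z0| < e by rewrite /s addrAC subrr add0r gtr0_norm; lra.
(* Minus the slope of [psi] between the sample points [z0] and [s]: the second difference gives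
   [phi] this slope. *)
pose k := - ((psi s - psi z0) / (s - z0)).
pose l := phi w0 - k * w0.
exists k, l, (l - psi z0 - k * z0), (- z0 * (l - psi z0) + Q z0).
apply: (ballR_near e0) => w we.
have E1 := eP _ _ we z0e; have E2 := eP _ _ we se.
have E3 := eP _ _ w0e z0e; have E4 := eP _ _ w0e se.
have phiE : phi w = k * w + l.
  apply: (mulfI sz); rewrite /l /k.
  transitivity ((s - z0) * phi w0 - (w - w0) * (psi s - psi z0)); last by field.
  lra.
split=> //; move: E1; rewrite phiE => E1.
have -> : P w = (w - z0) * (k * w + l - psi z0) + Q z0 by rewrite E1; ring.
by ring.
Qed.

(* Differentiating the quadratic identity and using [phi * g' = 1] gives
   [m * (1 + k * g w) = 2 * k * w + p]. *)
Lemma affine_of_quadratic (R : realType) (g phi : R -> R) (w0 k l m p q : R) :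
  (\forall w \near w0, derivable g w 1 /\ phi w * derive1 g w = 1) ->
  (\forall w \near w0, phi w = k * w + l /\
     m * (g w * phi w) = k * w ^+ 2 + p * w + q) ->
  exists a b, \forall w \near w0, g w = a * w + b.
Proof.
move=> gw phiw.
(* If [k = 0], then [phi] is the constant [l] and g' is its inverse. *)
have [k0|k0] := eqVneq k 0.
  exists l^-1, (g w0 - l^-1 * w0); apply: near_derive_cst_affine.
  near=> w.
  have [gd phig] : derivable g w 1 /\ phi w * derive1 g w = 1 by near: w.
  have [phil _] : phi w = k * w + l /\
     m * (g w * phi w) = k * w ^+ 2 + p * w + q by near: w.
  move: phig; rewrite phil k0 mul0r add0r => lg.
  have l0 : l != 0 by apply/eqP => l0; move: lg; rewrite l0; lra.
  have <- : derive1 g w = l^-1 by rewrite -[RHS]mulr1 -lg mulKf.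
  exact: is_derive1_derivable.
have dE : \forall w \near w0, m * (1 + k * g w) = 2 * k * w + p.
  apply: filterS2 gw (near_join phiw) => w [gd phig] phij.
  have [phil _] := nbhs_singleton phij.
  have E : \forall z \near w, m * (g z * (k * z + l)) = k * z ^+ 2 + p * z + q.
    by apply: filterS phij => z [<-].
  have gD := is_derive1_derivable gd.
  have D1 : is_derive w 1 (fun z => m * (g z * (k * z + l))) (m * (1 + k * g w)).
    rewrite phil in phig; apply: is_derive_eq; rewrite /GRing.scale/=.
    transitivity (m * ((k * w + l) * derive1 g w + k * g w)); first by ring.
    by rewrite phig.
  have D2 : is_derive w 1 (fun z => k * z ^+ 2 + p * z + q) (2 * k * w + p).
    by apply: is_derive_eq; rewrite /GRing.scale/=; ring.
  case: D1 => _ <-; case: D2 => _ <-.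
  exact: near_eq_derive.
(* With [m = 0] the identity [dE] would make [2 * k * w + p] vanish at two points, forcing
   [k = 0]. *)
have [m0|m0] := eqVneq m 0.
  have [e e0 eP] := near_ballR dE.
  have := eP w0; rewrite subrr normr0 => /(_ e0).
  have := eP (w0 + e / 2); rewrite addrAC subrr add0r gtr0_norm; last lra.
  rewrite m0 !mul0r => /(_ ltac:(lra)) E1 E2.
  have : k * e = 0 by lra.
  by move=> /eqP; rewrite mulf_eq0 (negbTE k0) gt_eqF.
exists (2 / m), ((p - m) / (m * k)); apply: filterS dE => w dE.
have mk : m * k != 0 by rewrite mulf_neq0.
apply: (mulfI mk); transitivity (2 * k * w + p - m); last by field; exact/andP.
lra.
Unshelve. all: by end_near. Qed.

(** Each equation is affine in [a] with nonzero leading coefficient, so it has exactly one root; the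
    two sides are minus these roots. The root of the first is inserted in the second. *)
Lemma io_X1_solution (R : realType) (g h : R -> R) (c d c' d' y v : R) :
  derive1 g (v + c * y) != 0 -> derive1 h (v + c' * y) != 0 ->
  (forall a, io_X1 g c d y v a = 0 <-> io_X1 h c' d' y v a = 0) ->
  c * v + (d * g (v + c * y) - y) / derive1 g (v + c * y) =
  c' * v + (d' * h (v + c' * y) - y) / derive1 h (v + c' * y).
Proof.
rewrite /io_X1.
set G := derive1 g _; set H := derive1 h _.
set x := g _; set z := h _ => G0 H0 /(_ (- (c * v + (d * x - y) / G))) [+ _].
have E1 : G * (- (c * v + (d * x - y) / G) + c * v) - (y - d * x) = 0 by field.
move=> /(_ E1) E2; apply: (mulfI H0).
transitivity (H * c' * v + (d' * z - y)); last by field.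
lra.
Qed.

(* As [c != c2], [w = v + c y] and [z = v + c2 y] are independent coordinates in
   place of [(y, v)], in which the equality of the two values of X1'' takes the
   form required by [separated_affine], with [phi = 1 / g'], [psi = 1 / h']. *)
Lemma equiv_io_branch_affine (R : realType) (f f2 g h : R -> R)
    (c d c2 d2 y v : R) :
  (forall x, derivable f x 1) -> (forall x, derivable f2 x 1) ->
  c != c2 ->
  local_inverse f g (v + c * y) -> local_inverse f2 h (v + c2 * y) ->
  (\forall y1 \near y & v1 \near v, forall a,
     io_X1 g c d y1 v1 a = 0 <-> io_X1 h c2 d2 y1 v1 a = 0) ->
  exists a b, \forall w \near (v + c * y), g w = a * w + b.
Proof.
move=> fd f2d cc2 fg f2h io.
pose dl := c - c2; have dl0 : dl != 0 by rewrite subr_eq0.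
have gn0 : \forall w \near (v + c * y), derivable g w 1 /\ (derive1 g w)^-1 * derive1 g w = 1.
  apply: filterS2 fg (near_local_inverse fg) => w [gd _] /(local_inverse_derive1_neq0 fd).
  by move=> g0; rewrite mulVf.
have eqn : \forall y1 \near y & v1 \near v,
   c * v1 + (d * g (v1 + c * y1) - y1) / derive1 g (v1 + c * y1) =
   c2 * v1 + (d2 * h (v1 + c2 * y1) - y1) / derive1 h (v1 + c2 * y1).
  have H1 := near_io (near_local_inverse fg).
  have H2 := near_io (near_local_inverse f2h).
  apply: filterS3 H1 H2 io => -[y1 v1]/= /(local_inverse_derive1_neq0 fd) g0.
  by move=> /(local_inverse_derive1_neq0 f2d) h0; exact: io_X1_solution.
have : \forall w \near (v + c * y) & z \near (v + c2 * y),
   (w - z) * ((derive1 g w)^-1 - (derive1 h z)^-1) =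
   dl * (d * (g w / derive1 g w) - c2 * w) - dl * (d2 * (h z / derive1 h z) - c * z).
  (* Solving [w = v + c * y], [z = v + c2 * y] for [y] and [v]; the determinant is [dl] up to
     sign. *)
  have yE : y = dl^-1 * (v + c * y) + (- dl^-1) * (v + c2 * y).
    by rewrite /dl; field.
  have vE : v = (- c2 / dl) * (v + c * y) + (c / dl) * (v + c2 * y).
    by rewrite /dl; field.
  move: yE vE; set W := v + c * y; set Z := v + c2 * y => yE vE.
  rewrite yE vE in eqn; have := near_linear2 eqn; apply: filterS => -[w z]/=.
  set y1 := dl^-1 * w + _; set v1 := - c2 / dl * w + _.
  have -> : v1 + c * y1 = w by rewrite /v1 /y1 /dl; field.
  have -> : v1 + c2 * y1 = z by rewrite /v1 /y1 /dl; field.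
  move=> E.
  have -> : w - z = dl * y1 by rewrite /y1; field.
  have E2 : c * v1 - c2 * v1 = c * z - c2 * w.
    by rewrite /v1 /dl; field.
  set G := (derive1 g w)^-1 in E *; set H := (derive1 h z)^-1 in E *.
  rewrite -mulrA -mulrBr; congr (_ * _).
  lra.
move=> /separated_affine[k [l [p [q E]]]].
(* Here [P w] is [dl * d * (g w * phi w) - dl * c2 * w]; moving the linear term to the right turns
   [p] into [p + dl * c2]. *)
apply: (@affine_of_quadratic _ g (fun w => (derive1 g w)^-1) _ k l (dl * d) (p + dl * c2) q) => //.
apply: filterS E => w [-> E]; split=> //.
lra.
Qed.

(** * Functions whose inverse is affine *)

Lemma local_inverse_affine (R : realType) (a b w0 : R) : a != 0 ->
  local_inverse (fun x => (x - b) / a) (fun w => a * w + b) w0.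
Proof.
move=> a0; rewrite /local_inverse; near=> w; split; last by field.
by case: (is_derive1_affine a b w).
Unshelve. all: by end_near. Qed.

Lemma affine_inverse_is_affine (R : realType) (a b : R) : a != 0 ->
  inverse_is_affine (fun x => (x - b) / a) a b.
Proof.
by move=> a0 w0 g; apply: filterS => w [_ {2}<-]; field.
Qed.

(** Near [x], f inverts the affine branch [a w + b] through [x], hence is itself affine with slope
    [a^-1]. *)
Lemma derive1_locally_cst (R : realType) (f : R -> R) (x : R) :
  (forall x, derivable f x 1) -> continuous (derive1 f) ->
  (forall (w0 : R) g, local_inverse f g w0 ->
    exists a b, \forall w \near w0, g w = a * w + b) ->
  derive1 f x != 0 -> \forall z \near x, derive1 f z = derive1 f x.
Proof.
move=> fd f'c gaff f'x.
have [g fg gfx] := local_inverse_exists fd f'c f'x.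
have [a [b gab]] := gaff _ _ fg.
have a0 : a != 0.
  by rewrite -(nbhs_singleton (near_affine_derive1 gab)) (local_inverse_derive1_neq0 fd fg).
have fab : \forall w \near (a^-1 * x + - b / a), f (a * w + b) = w.
  have -> : a^-1 * x + - b / a = f x.
    by rewrite -{1}gfx (nbhs_singleton gab); field.
  by apply: filterS2 fg gab => w [_ +] <-.
have cv : a^-1 * z + - b / a @[z --> x] --> a^-1 * x + - b / a.
  by apply: cvgD; [apply: cvgM; [exact: cvg_cst|exact: cvg_id]|exact: cvg_cst].
have faff : \forall z \near x, f z = a^-1 * z + (- b / a).
  have fabz : \forall z \near x,
      f (a * (a^-1 * z + - b / a) + b) = a^-1 * z + - b / a := cv _ fab.
  apply: filterS fabz => z.
  by have -> : a * (a^-1 * z + - b / a) + b = z by field.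
have f'a := near_affine_derive1 faff.
by rewrite (nbhs_singleton f'a); exact: f'a.
Qed.

Lemma affine_of_affine_branches (R : realType) (f : R -> R) :
  (forall x, derivable f x 1) -> continuous (derive1 f) ->
  locally_invertible f ->
  (forall (w0 : R) g, local_inverse f g w0 ->
    exists a b, \forall w \near w0, g w = a * w + b) ->
  exists a b, a != 0 /\ f = (fun x => (x - b) / a).
Proof.
move=> fd f'c fli gaff.
have f'cst (x : R) : derive1 f x != 0 -> is_derive x (1 : R) (derive1 f) 0.
  move=> /(derive1_locally_cst fd f'c gaff) f'x.
  apply: (@near_eq_is_derive _ _ _ (cst (derive1 f x))).
  by apply: filterS f'x => z ->.
(* At a zero [x] of f', isolation makes f' have derivative 0 on []x, x + e[]; continuity at [x] then
   gives f' the value 0 at [x + e / 2], a contradiction. *)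
have f'0 x : derive1 f x != 0.
  apply/eqP => f'x0.
  have /near_ballR[e e0 eP] := fli x f'x0.
  have f'n0 z : x < z < x + e -> derive1 f z != 0.
    move=> /andP[xz ze]; apply: eP; last by rewrite gt_eqF.
    by rewrite gtr0_norm; lra.
  have : derive1 f (x + e / 2) = derive1 f x.
    apply: derive0_itv_cst; first lra.
      exact: continuous_subspaceT.
    move=> z; rewrite in_itv/= => /andP[? ?].
    by apply: f'cst; apply: f'n0; apply/andP; split; lra.
  by rewrite f'x0; apply/eqP/f'n0; apply/andP; split; lra.
have f'E x : derive1 f x = derive1 f 0.
  by apply: is_derive_0_is_cst => z; exact: f'cst.
set m := derive1 f 0 in f'E; have m0 : m != 0 by exact: f'0.
exists m^-1, (- f 0 / m); split; first by rewrite invr_eq0.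
apply/funext => x.
have : f x - m * x = f 0 - m * 0.
  apply: (@is_derive_0_is_cst _ (fun x => f x - m * x)) => z.
  have fz := is_derive1_derivable (fd z).
  by apply: is_derive_eq; rewrite f'E /GRing.scale/=; ring.
rewrite mulr0 subr0 => E; have -> : f x = m * x + f 0 by rewrite -E; ring.
by field.
Qed.

Lemma has_affine_inverseP (R : realType) (f : R -> R) :
  (forall x, derivable f x 1) -> continuous (derive1 f) ->
  locally_invertible f -> has_affine_inverse f ->
  exists a b, a != 0 /\ f = (fun x => (x - b) / a).
Proof.
move=> fd f'c fli [a [b fab]]; apply: affine_of_affine_branches => //.
by move=> w0 g /fab; exists a, b.
Qed.

(** An affine inverse requires the same [a] and [b] on all branches. If each branch were affine with
    its own coefficients, [affine_of_affine_branches] would still yield a common pair. *)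
Lemma nonaffine_branch (R : realType) (f : R -> R) :
  (forall x, derivable f x 1) -> continuous (derive1 f) ->
  locally_invertible f -> ~ has_affine_inverse f ->
  exists (w0 : R) g, local_inverse f g w0 /\
    ~ exists a b, \forall w \near w0, g w = a * w + b.
Proof.
move=> fd f'c fli naff; apply: contrapT => nex; apply: naff.
have [|a [b [a0 ->]]] := affine_of_affine_branches fd f'c fli.
  by move=> w0 g fg; apply: contrapT => gn; apply: nex; exists w0, g.
by exists a, b; exact: affine_inverse_is_affine.
Qed.

(** * Observed [X1], non-affine inverse *)

(** With a common [c], both branches have the same argument [w]. At fixed [w] the solved equations
    are affine in [y]: the slopes give g' = h', then the constant terms give
    [d * g w = d2 * h w]. *)
Lemma equiv_io_same_c (R : realType) (f f2 g h : R -> R) (c d d2 y v : R) :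
  (forall x, derivable f x 1) -> (forall x, derivable f2 x 1) ->
  local_inverse f g (v + c * y) -> local_inverse f2 h (v + c * y) ->
  (\forall y1 \near y & v1 \near v, forall a,
     io_X1 g c d y1 v1 a = 0 <-> io_X1 h c d2 y1 v1 a = 0) ->
  \forall w \near (v + c * y), derive1 g w = derive1 h w /\ d * g w = d2 * h w.
Proof.
move=> fd f2d fg f2h io.
have : \forall y1 \near y & v1 \near v,
   [/\ derive1 g (v1 + c * y1) != 0, derive1 h (v1 + c * y1) != 0 &
   (d * g (v1 + c * y1) - y1) / derive1 g (v1 + c * y1) =
   (d2 * h (v1 + c * y1) - y1) / derive1 h (v1 + c * y1)].
  have H1 := near_io (near_local_inverse fg).
  have H2 := near_io (near_local_inverse f2h).
  apply: filterS3 H1 H2 io => -[y1 v1]/= /(local_inverse_derive1_neq0 fd) g0.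
  move=> /(local_inverse_derive1_neq0 f2d) h0 /(io_X1_solution g0 h0).
  by move=> /addrI.
set W := v + c * y.
(* Passage from [(y, v)] to the coordinates [(y, w)] with [w = v + c * y]. *)
have yE : 1 * y + 0 * W = y by ring.
have vE : - c * y + 1 * W = v by rewrite /W; ring.
rewrite -{1}yE -{1}vE => io1.
have /near_ballR2[e e0 eP] := near_linear2 io1.
apply: (ballR_near e0) => w we.
have := eP y w; have := eP (y + e / 2) w.
have yw (z : R) : - c * z + 1 * w + c * (1 * z + 0 * w) = w by ring.
have yz (z : R) : 1 * z + 0 * w = z by ring.
rewrite !yw !yz addrAC subrr add0r normr0 gtr0_norm; last lra.
move=> /(_ ltac:(lra) we)[g0 h0 E1] /(_ e0 we)[_ _ E2].
set G := derive1 g w in g0 E1 E2 *; set H := derive1 h w in h0 E1 E2 *.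
have GH : G^-1 = H^-1.
  have e20 : e / 2 != 0 by lra.
  by apply: (mulfI e20); lra.
split; first by rewrite -[G]invrK GH invrK.
have G'0 : G^-1 != 0 by rewrite invr_eq0.
by rewrite -GH in E2; have /addIr := mulIf G'0 E2.
Qed.

(** Differentiate [d * g = d2 * h] and cancel the common nonzero derivative; this also covers
    [d = 0]. *)
Lemma equiv_io_same_c_d (R : realType) (f f2 g h : R -> R) (c d d2 y v : R) :
  (forall x, derivable f x 1) -> (forall x, derivable f2 x 1) ->
  local_inverse f g (v + c * y) -> local_inverse f2 h (v + c * y) ->
  (\forall y1 \near y & v1 \near v, forall a,
     io_X1 g c d y1 v1 a = 0 <-> io_X1 h c d2 y1 v1 a = 0) ->
  d2 = d.
Proof.
move=> fd f2d fg f2h io; have gh := equiv_io_same_c fd f2d fg f2h io.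
have g0 := local_inverse_derive1_neq0 fd fg.
apply/esym/(mulIf g0); rewrite {2}(nbhs_singleton gh).1.
have [/is_derive1_derivable gD _] := nbhs_singleton fg.
have [/is_derive1_derivable hD _] := nbhs_singleton f2h.
have D1 : is_derive (v + c * y) 1 (fun w => d * g w) (d * derive1 g (v + c * y)).
  by apply: is_derive_eq; rewrite /GRing.scale/=; ring.
have D2 : is_derive (v + c * y) 1 (fun w => d2 * h w) (d2 * derive1 h (v + c * y)).
  by apply: is_derive_eq; rewrite /GRing.scale/=; ring.
case: D1 => _ <-; case: D2 => _ <-.
by apply: near_eq_derive; apply: filterS gh => w [].
Qed.

Lemma derivable_continuous (R : realType) (f : R -> R) :
  (forall x, derivable f x 1) -> continuous f.
Proof. by move=> fd x; apply/differentiable_continuous/derivable1_diffP. Qed.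

Lemma equiv_io_nonaffine (R : realType) (th th' : unknowns R) :
  admissible th -> locally_invertible (uf th) ->
  ~ has_affine_inverse (uf th) -> admissible th' -> equiv_io_X1 th th' ->
  [/\ uc th' = uc th, ud th' = ud th & (ud th != 0 -> uf th' = uf th)].
Proof.
case: th th' => [f c d] [f2 c2 d2] [/= fd f'c] fli naff [/= f2d _] [].
rewrite /io_X1_covered/= => cov _.
have [w0 [g [fg gn]]] := nonaffine_branch fd f'c fli naff.
(* A single non-affine branch, at the base point [y = 0], [v = w0], determines [c] and [d]. For f, a
   branch through each [x] with f' nonzero is needed below. *)
have w0E : w0 = w0 + c * 0 by ring.
rewrite w0E in fg gn.
have [h f2h io] := cov _ _ _ fg.
have cc2 : c2 = c.
  apply/eqP; apply: contra_notT gn; rewrite eq_sym => cc2.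
  exact: (equiv_io_branch_affine fd f2d cc2 fg f2h io).
subst c2.
have dd2 := equiv_io_same_c_d fd f2d fg f2h io.
subst d2; split=> // d0.
apply: (eq_of_dense_regular fli); try exact: derivable_continuous.
move=> x f'x.
have [g1 fg1 gx] := local_inverse_exists fd f'c f'x.
have fxE : f x = f x + c * 0 by ring.
rewrite fxE in fg1; have [h1 f2h1 io1] := cov _ _ _ fg1.
have [_ /(mulfI d0)] := nbhs_singleton (equiv_io_same_c fd f2d fg1 f2h1 io1).
rewrite mulr0 addr0 gx => xE; rewrite {1}xE.
by have := local_inverse_at f2h1; rewrite mulr0 addr0.
Qed.

Lemma same_io_X1_equiv (R : realType) (th th' : unknowns R) :
  same_io_X1 th th' -> equiv_io_X1 th th'.
Proof.
have incl th1 th2 : io_X1_covered (fun e e' : R => e = e') th1 th2 ->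
    io_X1_covered (fun e e' : R => e = 0 <-> e' = 0) th1 th2.
  move=> cov y v g /cov[h fh io]; exists h => //.
  by apply: filterS io => -[y1 v1]/= E a; rewrite E.
by case=> /incl ? /incl.
Qed.

(** * Observed [X1], affine inverse *)

(** The coefficient of the second derivative gives h' = [a], so [h] is affine near its base point.
    The coefficients of [v], of [y] and the constant term then give the sum, the product and
    [d2 * b2]. *)
Lemma affine_same_io_branch (R : realType) (h : R -> R) (a b c d c2 d2 y v : R) :
  a != 0 ->
  (\forall y1 \near y & v1 \near v, forall z,
     io_X1 (fun w => a * w + b) c d y1 v1 z = io_X1 h c2 d2 y1 v1 z) ->
  (\forall w \near (v + c2 * y), derivable h w 1) ->
  [/\ c2 + d2 = c + d, c2 * d2 = c * d &
    exists2 b2, d2 * b2 = d * b & h (v + c2 * y) = a * (v + c2 * y) + b2].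
Proof.
move=> a0 /near_ballR2[e e0 io] hd.
have gD w : derive1 (fun w => a * w + b) w = a.
  by rewrite derive1E; case: (is_derive1_affine a b w).
have slope y1 v1 : `|y1 - y| < e -> `|v1 - v| < e -> derive1 h (v1 + c2 * y1) = a.
  move=> y1e v1e; have := io _ _ y1e v1e 0; have := io _ _ y1e v1e 1.
  by rewrite /io_X1 gD; lra.
have /near_derive_cst_affine : \forall w \near (v + c2 * y), is_derive (w : R) (1 : R) h a.
  have sl : \forall w \near (v + c2 * y), derive1 h w = a.
    apply: (ballR_near e0) => w we.
    have <- : w - c2 * y + c2 * y = w by ring.
    apply: slope; first by rewrite subrr normr0.
    by move: we; rewrite opprD addrA addrAC.
  by apply: filterS2 hd sl => w /is_derive1_derivable + ha; rewrite ha.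
set b2 := h _ - _ => haff.
have /near_ballR2[r r0 rP] := near_io haff.
pose m := Num.min e r; have m0 : 0 < m by rewrite lt_min e0.
have E y1 v1 : `|y1 - y| < m -> `|v1 - v| < m ->
    d * (a * (v1 + c * y1) + b) + a * c * v1 = a * c2 * v1 + d2 * (a * (v1 + c2 * y1) + b2).
  rewrite !lt_min => /andP[y1e y1r] /andP[v1e v1r].
  have := io _ _ y1e v1e 0; rewrite /io_X1 gD (slope _ _ y1e v1e) (rP _ _ y1r v1r).
  lra.
have zm (z : R) : `|z - z| < m by rewrite subrr normr0.
have hm (z : R) : `|z + m / 2 - z| < m by rewrite addrAC subrr add0r gtr0_norm; lra.
have E0 := E _ _ (zm y) (zm v).
have Ey := E _ _ (hm y) (zm v).
have Ev := E _ _ (zm y) (hm v).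
have ma : a * m != 0 by rewrite mulf_neq0// gt_eqF.
have cd1 : c2 + d2 = c + d by apply: (mulfI ma); lra.
have cd2 : c2 * d2 = c * d by apply: (mulfI ma); lra.
split=> //; exists b2; last by rewrite /b2; ring.
have : d * b - d2 * b2 = a * v * (c2 + d2 - (c + d)) + a * y * (c2 * d2 - c * d) by lra.
by rewrite cd1 cd2 !subrr !mulr0 addr0 => /eqP; rewrite subr_eq0 => /eqP.
Qed.

Lemma affine_same_io (R : realType) (f2 : R -> R) (a b c d c2 d2 : R) : a != 0 ->
  same_io_X1 (Unknowns (fun x => (x - b) / a) c d) (Unknowns f2 c2 d2) ->
  [/\ c2 + d2 = c + d, c2 * d2 = c * d &
    d2 != 0 -> f2 = (fun x => (x - d * b / d2) / a)].
Proof.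
move=> a0 [cov _].
have br (v : R) : exists2 h : R -> R, local_inverse f2 h (v + c2 * 0) &
    [/\ c2 + d2 = c + d, c2 * d2 = c * d &
    exists2 b2, d2 * b2 = d * b & h (v + c2 * 0) = a * (v + c2 * 0) + b2].
  have [/= h f2h io] := cov 0 v _ (local_inverse_affine _ _ a0).
  exists h => //; apply: (affine_same_io_branch a0 io).
  by apply: filterS f2h => w [].
have [_ _ [cd1 cd2 _]] := br 0; split=> // d20.
apply/funext => x.
(* This base point is chosen so that the branch [h] of the inverse of [f2] takes the value [x]
   there. *)
have [h /local_inverse_at f2h [_ _ [b2 db hE]]] := br ((x - d * b / d2) / a).
move: f2h; rewrite hE mulr0 addr0 -db => f2h.
by rewrite -[RHS]f2h; congr f2; field; exact/andP.
Qed.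

Lemma affine_same_io_X1 (R : realType) (a b b2 c d c2 d2 : R) : a != 0 ->
  c2 + d2 = c + d -> c2 * d2 = c * d -> d2 * b2 = d * b ->
  same_io_X1 (Unknowns (fun x => (x - b) / a) c d)
             (Unknowns (fun x => (x - b2) / a) c2 d2).
Proof.
move=> a0.
have incl b1 b1' c1 d1 c1' d1' : c1' + d1' = c1 + d1 -> c1' * d1' = c1 * d1 ->
    d1' * b1' = d1 * b1 -> io_X1_covered (fun e e' : R => e = e')
      (Unknowns (fun x => (x - b1) / a) c1 d1)
      (Unknowns (fun x => (x - b1') / a) c1' d1').
  move=> cd1 cd2 db y v g /= /(affine_inverse_is_affine a0) gE.
  exists (fun w => a * w + b1'); first exact: local_inverse_affine.
  have H1 := near_io gE; have H2 := near_io (near_affine_derive1 gE).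
  apply: filterS2 H1 H2 => -[y1 v1]/= E1 E2 z.
  have gD w : derive1 (fun w => a * w + b1') w = a.
    by rewrite derive1E; case: (is_derive1_affine a b1' w).
  rewrite /io_X1 E1 E2 gD; apply/eqP; rewrite -subr_eq0; apply/eqP.
  transitivity (a * v1 * (c1 + d1 - (c1' + d1')) + a * y1 * (c1 * d1 - c1' * d1')
    + (d1 * b1 - d1' * b1')); first by ring.
  by rewrite cd1 cd2 db !subrr !mulr0 !addr0.
by move=> cd1 cd2 db; split; apply: incl.
Qed.

Lemma same_io_X1_slopes (R : realType) (th th' : unknowns R) :
  same_io_X1 th th' -> inverse_slopes (uf th') = inverse_slopes (uf th).
Proof.
have incl th1 th2 : io_X1_covered (fun e e' : R => e = e') th1 th2 ->
    inverse_slopes (uf th1) `<=` inverse_slopes (uf th2).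
  move=> cov s [w0 [g [fg <-]]].
  rewrite -(addr0 w0) -(mulr0 (uc th1)) in fg *.
  have [h fh /near_ballR2[e e0 io]] := cov _ _ _ fg.
  have {}io := io 0 w0; rewrite !subrr !normr0 in io; move/(_ e0 e0) in io.
  exists (w0 + uc th2 * 0), h; split=> //.
  (* Subtracting the equations at [a = 0] and [a = 1] isolates the derivative of the branch. *)
  by have := io 0; have := io 1; rewrite /io_X1; lra.
by case=> /incl ? /incl ?; apply/seteqP.
Qed.

(** * Local identifiability from finitely many values, and its use in the affine case *)

Lemma locally_identifiable_gap (R : realType)
    (same : unknowns R -> unknowns R -> Prop) (V : Type) (dist : V -> V -> \bar R)
    (q : unknowns R -> V) (th : unknowns R) (e : R) : 0 < e ->
  (forall th', admissible th' -> same th th' ->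
     q th' = q th \/ (e%:E <= dist (q th') (q th))%E) ->
  locally_identifiable same dist q th.
Proof.
move=> e0 gap; exists e => // th' adm sm.
by case: (gap th' adm sm) => // le_e; rewrite ltNge le_e.
Qed.

Lemma locally_identifiable_two_values (R : realType)
    (same : unknowns R -> unknowns R -> Prop) (q : unknowns R -> R)
    (th : unknowns R) (s : R) :
  (forall th', admissible th' -> same th th' -> q th' = q th \/ q th' = s) ->
  locally_identifiable same (@scalar_dist R) q th.
Proof.
move=> two; have [sE|sN] := eqVneq s (q th).
  by exists 1 => // th' adm sm _; case: (two th' adm sm) => // ->.
apply: (@locally_identifiable_gap _ _ _ _ _ _ `|s - q th|).
  by rewrite normr_gt0 subr_eq0.
by move=> th' adm /two-/(_ adm)[->|->]; [left|right; exact: lexx].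
Qed.

Lemma sup_dist_ge (R : realType) (D : set R) (f g : R -> R) (x : R) :
  D x -> ((`|f x - g x|)%:E <= sup_dist D f g)%E.
Proof. by move=> Dx; apply: ereal_sup_ubound; exists x. Qed.

Lemma admissible_affine (R : realType) (m q c d : R) :
  admissible (Unknowns (fun x => m * x + q) c d).
Proof.
split=> /= [x|]; first by case: (is_derive1_affine m q x).
have -> : derive1 (fun x => m * x + q) = cst m.
  by apply/funext => x; rewrite derive1E; case: (is_derive1_affine m q x).
exact: cst_continuous.
Qed.

Lemma affine_sum_prod_swap (R : realType) (c d c2 d2 : R) :
  c2 + d2 = c + d -> c2 * d2 = c * d ->
  (c2 = c /\ d2 = d) \/ (c2 = d /\ d2 = c).
Proof.
(* [c2] is a root of the polynomial with roots [c] and [d]. *)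
move=> s p; have /eqP : (c2 - c) * (c2 - d) = 0.
  transitivity (c2 * (c2 + d2 - (c + d)) + (c * d - c2 * d2)); first by ring.
  by rewrite s p !subrr mulr0 addr0.
rewrite mulf_eq0 !subr_eq0 => /orP[] /eqP E; [left|right]; split=> //; lra.
Qed.

Lemma same_io_affine (R : realType) (a b c d : R) :
  let th := Unknowns (fun x => (x - b) / a) c d in
  a != 0 -> c != 0 ->
  [/\ locally_identifiable (@same_io_X1 R) (@scalar_dist R) (@uc R) th,
      locally_identifiable (@same_io_X1 R) (@scalar_dist R) (@ud R) th &
      (d != 0 -> forall D : set R, D !=set0 ->
       locally_identifiable (@same_io_X1 R) (sup_dist D) (@uf R) th)] /\
  [/\ (c != d -> ~ globally_identifiable (@same_io_X1 R) (@uc R) th),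
      (c != d -> ~ globally_identifiable (@same_io_X1 R) (@ud R) th) &
      (c != d -> b != 0 ->
       ~ globally_identifiable (@same_io_X1 R) (@uf R) th)].
Proof.
move=> th a0 c0.
pose th2 := Unknowns (fun x => (x - d * b / c) / a) d c.
have adm2 : admissible th2.
  rewrite /th2; have -> : (fun x => (x - d * b / c) / a) =
      (fun x => a^-1 * x + (- (d * b / c)) / a).
    by apply/funext => x; field; exact/andP.
  exact: admissible_affine.
have same2 : same_io_X1 th th2.
  by apply: affine_same_io_X1 => //; [ring|ring|field].
split; split.
- apply: (@locally_identifiable_two_values _ _ _ _ d) => -[f2 c2 d2] _.
  by move=> /(affine_same_io a0)[/affine_sum_prod_swap s /s[|] [-> _] _]; [left|right].
- apply: (@locally_identifiable_two_values _ _ _ _ c) => -[f2 c2 d2] _.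
  by move=> /(affine_same_io a0)[/affine_sum_prod_swap s /s[|] [_ ->] _]; [left|right].
- move=> d0 D [x Dx].
  have two th' : same_io_X1 th th' -> uf th' = uf th \/ uf th' = uf th2.
    case: th' => f2 c2 d2 /(affine_same_io a0)[/affine_sum_prod_swap s /s].
    move=> [|] [_ ->] /=; [move=> /(_ d0)|move=> /(_ c0)] => ->; [left|by right].
    by apply/funext => z; field; exact/andP.
  have [bE|bN] := eqVneq (d * b / c) b.
    by exists 1 => // th' _ /two[]// + _ => ->; rewrite /= bE.
  (* The two possible functions differ by a constant, so their distance over any nonempty [D] is at
     least its absolute value. *)
  apply: (@locally_identifiable_gap _ _ _ _ _ _ `|(b - d * b / c) / a|).
    by rewrite normr_gt0 mulf_neq0 ?invr_eq0// subr_eq0 eq_sym.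
  move=> th' _ /two[->|->]; [by left|right].
  have := sup_dist_ge (uf th2) (uf th) Dx; apply: le_trans; rewrite lee_fin /=.
  suff -> : (b - d * b / c) / a = (x - d * b / c) / a - (x - b) / a by [].
  by field; exact/andP.
- by move=> cd /(_ _ adm2 same2)/= dc; move: cd; rewrite dc eqxx.
- by move=> cd /(_ _ adm2 same2)/= dc; move: cd; rewrite dc eqxx.
- move=> cd b0 /(_ _ adm2 same2)/= /(congr1 (fun f => f 0)).
  have a'0 : a^-1 != 0 by rewrite invr_eq0.
  rewrite !sub0r => /(mulIf a'0)/oppr_inj E.
  have : d * b = c * b by rewrite -[in RHS]E; field.
  by move=> /(mulIf b0) dc; move: cd; rewrite dc eqxx.
Qed.

(** * Observed [X2] *)

Lemma same_io_X2P (R : realType) (th th' : unknowns R) :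
  same_io_X2 th th' <->
  uc th' + ud th' = uc th + ud th /\
  forall x, uf th' x - uc th' * ud th' * x = uf th x - uc th * ud th * x.
Proof.
rewrite /same_io_X2 /io_X2; split=> [io|[cd fcd] y v a].
  split=> [|x]; last by have := io x 0 0; lra.
  by have := io 0 0 0; have := io 0 1 0; lra.
have := fcd y; rewrite (_ : uc th' = uc th + ud th - ud th'); last lra.
by move=> E; lra.
Qed.

Lemma same_io_X2_outputs_included (R : realType) (th th' : unknowns R) :
  same_io_X2 th th' -> outputs_X2_included th th'.
Proof.
move=> /same_io_X2P[cd fcd] T X1 X2 T0 [X1c X2c dX].
(* This [Z1] satisfies [Z1 - d' X2 = X1 - d X2], which leaves the equation for [X2] unchanged. *)
exists (fun t => X1 t + (ud th' - ud th) * X2 t), X2; split=> //; split=> //.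
  move=> t; apply: cvgD; first exact: X1c.
  by apply: cvgM; [exact: cvg_cst|exact: X2c].
move=> t /dX[dX1 dX2]; split; apply: is_derive_eq; last by rewrite /=; ring.
have -> : uf th' (X2 t) = uf th (X2 t) + (uc th' * ud th' - uc th * ud th) * X2 t.
  by have := fcd (X2 t); lra.
have -> : uc th' = uc th + ud th - ud th' by lra.
by rewrite /GRing.scale/=; ring.
Qed.

Lemma same_io_X2_sym (R : realType) (th th' : unknowns R) :
  same_io_X2 th th' -> same_io_X2 th' th.
Proof. by move=> io y v a. Qed.

(** With [d2 = c + d - c2], the coefficient of [x] is [c2 * d2 - c * d], exactly what keeps
    [f x - c * d * x] fixed. *)
Definition reparam_X2 (R : realType) (th : unknowns R) (c2 : R) : unknowns R :=
  Unknowns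
    (fun x => uf th x +
       (c2 * uc th + c2 * ud th - c2 ^+ 2 - uc th * ud th) * x)
    c2 (uc th + ud th - c2).

Lemma admissible_reparam_X2 (R : realType) (th : unknowns R) (c2 : R) :
  admissible th -> admissible (reparam_X2 th c2).
Proof.
case: th => f c d [/= fd f'c]; rewrite /admissible/=.
set k := c2 * c + _ - _ - _.
have fD (x : R) : is_derive x (1 : R) (fun x => f x + k * x) (derive1 f x + k).
  have fx := is_derive1_derivable (fd x).
  by apply: is_derive_eq; rewrite /GRing.scale/=; ring.
split=> [x|]; first by case: (fD x).
have -> : derive1 (fun x => f x + k * x) = (fun x => derive1 f x + k).
  by apply/funext => x; rewrite derive1E; case: (fD x).
by move=> x; apply: cvgD; [exact: f'c|exact: cvg_cst].
Qed.

Lemma same_io_reparam_X2 (R : realType) (th : unknowns R) (c2 : R) :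
  same_io_X2 th (reparam_X2 th c2).
Proof. by apply/same_io_X2P; split=> [|x] /=; ring. Qed.

Lemma globally_locally_identifiable (R : realType)
    (same : unknowns R -> unknowns R -> Prop) (V : Type) (dist : V -> V -> \bar R)
    (q : unknowns R -> V) (th : unknowns R) :
  globally_identifiable same q th -> locally_identifiable same dist q th.
Proof. by move=> gid; exists 1 => // th' adm sm _; exact: gid. Qed.

Lemma nonidentifiable_approx (R : realType)
    (same : unknowns R -> unknowns R -> Prop) (V : Type) (dist : V -> V -> \bar R)
    (q : unknowns R -> V) (th : unknowns R) :
  (forall e : R, 0 < e -> exists th', [/\ admissible th', same th th',
     (dist (q th') (q th) < e%:E)%E & q th' <> q th]) ->
  nonidentifiable same dist q th.
Proof.
move=> approx.
have nloc : ~ locally_identifiable same dist q th.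
  by move=> [e /approx[th' [adm sm qe qn]] /(_ _ adm sm qe)].
by split=> // /(globally_locally_identifiable dist).
Qed.

Lemma nonidentifiable_X2_uc (R : realType) (th : unknowns R) : admissible th ->
  nonidentifiable (@same_io_X2 R) (@scalar_dist R) (@uc R) th.
Proof.
move=> adm; apply: nonidentifiable_approx => e e0.
exists (reparam_X2 th (uc th + e / 2)); split.
- exact: admissible_reparam_X2.
- exact: same_io_reparam_X2.
- by rewrite /scalar_dist/= addrAC subrr add0r lte_fin gtr0_norm; lra.
- by rewrite /=; lra.
Qed.

Lemma nonidentifiable_X2_ud (R : realType) (th : unknowns R) : admissible th ->
  nonidentifiable (@same_io_X2 R) (@scalar_dist R) (@ud R) th.
Proof.
move=> adm; apply: nonidentifiable_approx => e e0.
exists (reparam_X2 th (uc th - e / 2)); split.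
- exact: admissible_reparam_X2.
- exact: same_io_reparam_X2.
- have -> : ud (reparam_X2 th (uc th - e / 2)) = ud th + e / 2 by rewrite /=; ring.
  by rewrite /scalar_dist addrAC subrr add0r lte_fin gtr0_norm; lra.
- by rewrite /=; lra.
Qed.

(** Moving [c] slightly adds a small linear term [k * x] to f, which is uniformly small on a bounded
    [D]. *)
Lemma nonidentifiable_X2_uf (R : realType) (th : unknowns R) (D : set R) :
  bounded_set D -> admissible th ->
  nonidentifiable (@same_io_X2 R) (sup_dist D) (@uf R) th.
Proof.
move=> [M0 [_ MP]] adm; apply: nonidentifiable_approx => e e0.
pose M := `|M0| + 1.
have M0' : 0 < M by rewrite ltr_wpDl.
have DM x : D x -> `|x| <= M.
  by apply: MP; rewrite /M; have := ler_norm M0; lra.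
pose A := `|ud th - uc th| + 1.
have A0 : 0 < A by rewrite ltr_wpDl.
(* The bound [t <= 1] gives [|k| <= t * A], and the second bound then gives [|k| * M <= e / 2]. *)
pose t := Num.min 1 (e / (2 * M * A)).
have MA0 : 0 < M * A by rewrite mulr_gt0.
have t0 : 0 < t by rewrite lt_min ltr01/= divr_gt0// -mulrA mulr_gt0.
have t1 : t <= 1 by rewrite ge_min lexx.
have te : t * (M * A) <= e / 2.
  have -> : e / 2 = e / (2 * M * A) * (M * A).
    by field; rewrite !gt_eqF.
  by rewrite ler_pM2r// ge_min lexx orbT.
(* The sign makes [- s * t] reinforce [d - c], so that [k] cannot vanish. *)
pose s : R := if uc th <= ud th then -1 else 1.
pose k := s * t * (ud th - uc th - s * t).
have kE : `|k| = t * (`|ud th - uc th| + t).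
  rewrite /k /s; case: leP => cd.
    rewrite (ger0_norm (x := ud th - uc th)); last lra.
    by rewrite normrM !mulN1r normrN opprK !ger0_norm//; lra.
  rewrite (ltr0_norm (x := ud th - uc th)); last lra.
  rewrite normrM !mul1r (gtr0_norm t0) (ltr0_norm (x := _ - _ - _)); last lra.
  by congr (_ * _); ring.
have k0 : `|k| != 0.
  by rewrite kE mulf_neq0// gt_eqF// ltr_wpDl.
have kM : `|k| * M <= e / 2.
  apply: le_trans te; rewrite kE -mulrA; apply: ler_wpM2l; first exact: ltW.
  by rewrite mulrC; apply: ler_wpM2l; [exact: ltW|rewrite /A lerD2l].
pose th' := reparam_X2 th (uc th + s * t).
have th'E x : uf th' x = uf th x + k * x by rewrite /th' /k/=; ring.
exists th'; split.
- exact: admissible_reparam_X2.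
- exact: same_io_reparam_X2.
- apply: (@le_lt_trans _ _ (e / 2)%:E); last by rewrite lte_fin; lra.
  apply: ub_ereal_sup => _ [x Dx <-]; rewrite lee_fin th'E addrAC subrr add0r normrM.
  apply: le_trans kM; apply: ler_wpM2l => //; exact: DM.
- move=> /(congr1 (fun f => f 1)); rewrite th'E mulr1 => E.
  by move/eqP: k0; apply; apply/eqP; rewrite normr_eq0; apply/eqP; lra.
Qed.

(** * The two observation settings together *)

Theorem proposition4p2 (R : realType) :
  (* (i) X1 observed; ud th != 0, and in the affine case also uc th != ud th and
     uf th 0 != 0 (i.e. f^-1(0) != 0), express that th is generic, and are
     assumed only where needed *)
  (forall th : unknowns R,
     admissible th -> locally_invertible (uf th) -> uc th != 0 ->
     (* f^-1 non-affine *)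
     (~ has_affine_inverse (uf th) ->
        [/\ globally_identifiable (@same_io_X1 R) (@uc R) th,
            globally_identifiable (@same_io_X1 R) (@ud R) th &
            (ud th != 0 ->
             globally_identifiable (@same_io_X1 R) (@uf R) th)] /\
        [/\ globally_identifiable (@equiv_io_X1 R) (@uc R) th,
            globally_identifiable (@equiv_io_X1 R) (@ud R) th &
            (ud th != 0 ->
             globally_identifiable (@equiv_io_X1 R) (@uf R) th)]) /\
     (* f^-1 affine *)
     (has_affine_inverse (uf th) ->
        [/\ locally_identifiable (@same_io_X1 R) (@scalar_dist R) (@uc R) th,
            locally_identifiable (@same_io_X1 R) (@scalar_dist R) (@ud R) th &
            (ud th != 0 -> forall D : set R, D !=set0 ->
             locally_identifiable (@same_io_X1 R) (sup_dist D) (@uf R) th)] /\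
        [/\ (uc th != ud th ->
             ~ globally_identifiable (@same_io_X1 R) (@uc R) th),
            (uc th != ud th ->
             ~ globally_identifiable (@same_io_X1 R) (@ud R) th) &
            (uc th != ud th -> uf th 0 != 0 ->
             ~ globally_identifiable (@same_io_X1 R) (@uf R) th)] /\
        globally_identifiable (@same_io_X1 R)
          (fun th' => inverse_slopes (uf th')) th)) /\
  (* (ii) X2 observed *)
  (forall th : unknowns R, admissible th ->
     [/\ (forall D : set R, bounded_set D ->
            nonidentifiable (@same_io_X2 R) (sup_dist D) (@uf R) th),
         nonidentifiable (@same_io_X2 R) (@scalar_dist R) (@uc R) th &
         nonidentifiable (@same_io_X2 R) (@scalar_dist R) (@ud R) th] /\
     [/\ globally_identifiable (@same_io_X2 R)
           (fun th' => uc th' + ud th') th &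
         globally_identifiable (@same_io_X2 R)
           (fun th' => fun x : R => uf th' x - uc th' * ud th' * x) th] /\
     (* only these: any identifiable quantity is determined by them *)
     (forall (V : Type) (q : unknowns R -> V),
        globally_identifiable (@same_io_X2 R) q th ->
        forall th' : unknowns R, admissible th' ->
          uc th' + ud th' = uc th + ud th ->
          (forall x : R, uf th' x - uc th' * ud th' * x =
                         uf th x - uc th * ud th * x) ->
          q th' = q th) /\
     (forall c2 : R,
        let c1 := uc th in
        let d1 := ud th in
        let th2 := Unknowns
          (fun x => uf th x + (c2 * c1 + c2 * d1 - c2 ^+ 2 - c1 * d1) * x)
          c2 (c1 + d1 - c2) in
        [/\ admissible th2, same_io_X2 th th2 & same_outputs_X2 th th2])).
Proof.
split=> [th adm fli c0|th adm].
  split=> [naff|aff].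
    have key th' : admissible th' -> equiv_io_X1 th th' ->
        [/\ uc th' = uc th, ud th' = ud th & (ud th != 0 -> uf th' = uf th)].
      exact: equiv_io_nonaffine.
    (* Equality of the equations implies equality of their solutions, so the coarser relation
       settles both. *)
    have key_same th' adm' (sm : same_io_X1 th th') := key th' adm' (same_io_X1_equiv sm).
    split; split=> [th' adm' sm|th' adm' sm|d0 th' adm' sm].
    - by case: (key_same _ adm' sm).
    - by case: (key_same _ adm' sm).
    - by case: (key_same _ adm' sm) => _ _; apply.
    - by case: (key _ adm' sm).
    - by case: (key _ adm' sm).
    - by case: (key _ adm' sm) => _ _; apply.
  have [fd f'c] := adm.
  have [a [b [a0 fE]]] := has_affine_inverseP fd f'c fli aff.
  case: th fE c0 {adm fli aff fd f'c} => f c d /= -> c0.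
  have [loc [gc gd gf]] := same_io_affine b d a0 c0.
  split=> //; split; last by move=> th' _; exact: same_io_X1_slopes.
  (* Here f takes the value [- b / a] at 0, so [uf th 0 != 0] forces [b != 0]. *)
  split=> // cd fb; apply: gf => //; apply: contra_neq fb => ->.
  by rewrite subr0 mul0r.
split.
  split=> [D Dbd||].
  - exact: nonidentifiable_X2_uf.
  - exact: nonidentifiable_X2_uc.
  - exact: nonidentifiable_X2_ud.
split.
  split=> th' _ /same_io_X2P[cd fcd] //.
  by apply/funext => x; exact: fcd.
split.
  move=> V q qid th' adm' cd fcd; apply: qid => //.
  exact/same_io_X2P.
move=> c2 c1 d1 th2.
have io : same_io_X2 th th2 by exact: same_io_reparam_X2.
split=> //; first exact: admissible_reparam_X2.
by split; apply: same_io_X2_outputs_included => //; exact: same_io_X2_sym.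
Qed.
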